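(* Let $a$ be an integer with $a\ge 2$, and let $K_n$ be an edge-colored complete graph of order $n$ with $\delta^c(K_n)\ge a+3$. Then $K_n$ has an $(a,2)$-feasible partition, i.e. $V(K_n)$ can be partitioned into two non-empty sets $A$ and $B$ such that $\delta^c(K_n[A])\ge a$ and $\delta^c(K_n[B])\ge 2$.
   Context: All graphs are finite and simple, and have non-empty vertex set. An edge-colored graph is a graph together with an arbitrary (not necessarily proper) assignment of a color to each edge. For a vertex $v$ of an edge-colored graph $G$, the color degree $d^c_G(v)$ is the number of distinct colors appearing on the edges of $G$ incident with $v$, and $\delta^c(G)=\min\{d^c_G(v): v\in V(G)\}$. $G[A]$ is the subgraph induced by $A$ with the inherited edge-coloring. *)

(* Defs.v *)
From mathcomp Require Import all_boot.

Set Implicit Arguments.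
Unset Strict Implicit.
Unset Printing Implicit Defensive.

(* Only the values of [color] on adjacent pairs are meaningful. The symmetry
   condition says that these values are colors of undirected edges. *)
Record ecgraph (C : eqType) := ECGraph {
  vertex :> finType;
  adj : rel vertex;
  color : vertex -> vertex -> C;
  adj_sym : symmetric adj;
  adj_irrefl : irreflexive adj;
  color_sym : forall u v, adj u v -> color u v = color v u
}.

Section ColoredGraphs.
Variables (C : eqType) (G : ecgraph C).

Definition complete := forall u v : G, u != v -> adj u v.

Definition color_degree (v : G) : nat :=
  size (undup [seq color v w | w in adj v]).

(* A color degree never exceeds #|G|, so for nonempty G the initial value #|G|
   does not affect the minimum. For empty G the value is 0. *)
Definition min_color_degree : nat :=
  \big[minn/#|G|]_(v : G) color_degree v.

Fact color_degree_le_card (v : G) : color_degree v <= #|G|.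
Proof.
apply: leq_trans (size_undup _) _.
by rewrite size_map -cardE max_card.
Qed.

Fact leq_min_color_degreeP (k : nat) : 0 < #|G| ->
  (k <= min_color_degree) <-> (forall v : G, k <= color_degree v).
Proof.
move=> /card_gt0P[v0 _]; rewrite /min_color_degree; split=> [le_k v|le_k].
  move: le_k; have: v \in index_enum G by rewrite mem_index_enum.
  elim: index_enum => // u s IHs; rewrite inE big_cons leq_min.
  by case/orP=> [/eqP-> /andP[]|v_s /andP[_]] //; apply: IHs.
elim/big_ind: _ => [|x y k_x k_y|v _].
- exact: leq_trans (le_k v0) (color_degree_le_card v0).
- by rewrite leq_min k_x.
- exact: le_k.
Qed.

Variable A : {set G}.

Let W : finType := {x : G | x \in A}.

Definition induced_adj : rel W := fun u v => adj (val u) (val v).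

Definition induced_color (u v : W) : C := color (val u) (val v).

Fact induced_adj_sym : symmetric induced_adj.
Proof. by move=> u v; apply: adj_sym. Qed.

Fact induced_adj_irrefl : irreflexive induced_adj.
Proof. by move=> u; apply: adj_irrefl. Qed.

Fact induced_color_sym u v :
  induced_adj u v -> induced_color u v = induced_color v u.
Proof. exact: color_sym. Qed.

Definition induced : ecgraph C :=
  ECGraph induced_adj_sym induced_adj_irrefl induced_color_sym.

End ColoredGraphs.

Definition feasible_partition (C : eqType) (G : ecgraph C) (a b : nat)
    (A B : {set G}) : Prop :=
  [/\ A != set0, B != set0, A :|: B = [set: G] & [disjoint A & B]] /\
  a <= min_color_degree (induced A) /\ b <= min_color_degree (induced B).

(* Main.v *)
Require Import Defs.
From mathcomp Require Import all_boot.

(** It is enough to find a set [B] of at most four vertices with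
    [2 <= min_color_degree (induced B)] such that every vertex outside [B] sees
    at most three colors on [B]: removing [B] then costs each other vertex at
    most three of its [a + 3] colors ([feasible_of_small]).

    The vertex set of a rainbow triangle is such a [B].  If no triangle is
    rainbow, then the vertex set of a properly colored 4-cycle is one as well:
    a vertex that saw four different colors on the cycle would create a rainbow
    triangle ([few_colors_on_cycle]).  One of the two configurations exists,
    since otherwise some vertex would have all its edges of one color
    ([monochromatic_star]), while every color degree is at least [a + 3]. *)

Set Implicit Arguments.
Unset Strict Implicit.
Unset Printing Implicit Defensive.

(** * Counting the values of a function *)

Section CountingValues.

Variable C : eqType.

Lemma size_undup_subset (s1 s2 : seq C) :
  {subset s1 <= s2} -> size (undup s1) <= size (undup s2).
Proof.
move=> s12; apply: uniq_leq_size (undup_uniq _) _ => x.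
by rewrite !mem_undup; apply: s12.
Qed.

Lemma size_undup_cat (s1 s2 : seq C) :
  size (undup (s1 ++ s2)) <= size (undup s1) + size (undup s2).
Proof.
rewrite -size_cat; apply: uniq_leq_size (undup_uniq _) _ => x.
by rewrite !(mem_undup, mem_cat).
Qed.

Lemma size_undup_gt1 (s : seq C) x y :
  x \in s -> y \in s -> x != y -> 1 < size (undup s).
Proof.
move=> xs ys xy; apply: (@uniq_leq_size _ [:: x; y]); first by rewrite /= inE xy.
by move=> z; rewrite !inE mem_undup => /orP[] /eqP->.
Qed.

Lemma size_undup_constant (s : seq C) k :
  (forall x, x \in s -> x = k) -> size (undup s) <= 1.
Proof.
move=> sk; apply: (@uniq_leq_size _ _ [:: k]); first exact: undup_uniq.
by move=> x; rewrite mem_undup inE => /sk ->.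
Qed.

Variables (T : finType) (f : T -> C) (B : {set T}).

Lemma size_undup_image : size (undup [seq f w | w in B]) <= #|B|.
Proof. by apply: leq_trans (size_undup _) _; rewrite size_map -cardE. Qed.

End CountingValues.

Lemma size_undup_image_noninj (C : eqType) (T : finType) (f : T -> C)
    (B : {set T}) x y :
  x \in B -> y \in B -> x != y -> f x = f y ->
  size (undup [seq f w | w in B]) < #|B|.
Proof.
move=> xB yB xy fxy; rewrite (cardsD1 x B) xB ltnS.
apply: leq_trans (size_undup_image f (B :\ x)); apply: size_undup_subset => k.
case/imageP=> w wB ->; have [->|wx] := eqVneq w x.
  by rewrite fxy image_f // !inE eq_sym xy.
by rewrite image_f // !inE wx.
Qed.

Lemma color_degree_le_induced (C : eqType) (K : ecgraph C) (A : {set K})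
    (v : induced A) :
  color_degree (val v) <=
  color_degree v + size (undup [seq color (val v) w | w in ~: A]).
Proof.
apply: leq_trans (size_undup_cat _ _); apply: size_undup_subset => k.
case/imageP=> w vw ->; rewrite mem_cat.
have [wA|wA] := boolP (w \in A); last by rewrite orbC image_f // inE.
apply/orP; left; apply/imageP; by exists (Sub w wA).
Qed.

(** * Rainbow triangles and properly colored 4-cycles *)

Section CompleteGraph.

Variables (C : eqType) (K : ecgraph C).
Hypothesis complK : complete K.

Local Notation c := (@color C K).

Lemma color_symC (u v : K) : u != v -> c u v = c v u.
Proof. by move=> /complK; apply: color_sym. Qed.

Definition rainbow (x y z : K) : bool :=
  uniq [:: x; y; z] && uniq [:: c x y; c y z; c z x].

Definition proper_cycle4 (x y z w : K) : bool :=
  uniq [:: x; y; z; w] &&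
  [&& c x y != c y z, c y z != c z w, c z w != c w x & c w x != c x y].

Definition rainbow_free : Prop := forall x y z : K, ~~ rainbow x y z.

Lemma rainbow_freeE (x y z : K) :
  rainbow_free -> x != y -> y != z -> z != x ->
  [\/ c x y = c y z, c y z = c z x | c z x = c x y].
Proof.
move=> /(_ x y z) + xy yz zx; rewrite /rainbow /= !inE !negb_or xy yz.
rewrite (eq_sym x z) zx !andbT /= !negb_and !negbK.
rewrite (eq_sym (c x y) (c z x)).
by case/orP=> [/orP[]|] /eqP ?; [constructor 1|constructor 3|constructor 2].
Qed.

(** Induction on [S].  Delete [v] and let [u] have all its remaining edges of
    color [k].  If neither [u] nor [v] works in [S], then [u v] has a color
    [d != k] and some edge [v t] has a color other than [d], which must be [k]
    because the triangle [u v t] is not rainbow.  Then [t] works: an edge [t z]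
    of another color than [k] would close the properly colored cycle [u v t z],
    with colors [d], [k], [c t z], [k]. *)
Lemma monochromatic_star (S : {set K}) :
  rainbow_free -> (forall x y z w, ~~ proper_cycle4 x y z w) ->
  S != set0 ->
  exists2 u : K, u \in S &
    exists k, forall w, w \in S -> w != u -> c u w = k.
Proof.
move=> noR noC; have [m] := ubnP #|S|.
elim: m S => // m IHm S leSm /set0Pn[v vS].
have [S'0|/IHm[]] := eqVneq (S :\ v) set0.
- (* The star of [v] in [S] has no edge, so any color will do. *)
  exists v => //; exists (c v v) => w wS wv.
  by have := in_set0 w; rewrite -S'0 !inE wS wv.
- by move: leSm; rewrite (cardsD1 v S) vS.
move=> u; rewrite !inE => /andP[uv uS] [k uk].
have {}uk w : w \in S -> w != v -> w != u -> c u w = k.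
  by move=> wS wv; apply: uk; rewrite !inE wv.
have [cuv|cuv] := eqVneq (c u v) k.
  exists u => //; exists k => w wS wu.
  by have [->|wv] := eqVneq w v => //; apply: uk.
have [/'forall_implyP vmono|] :=
  boolP [forall w, (w \in S :\ v) ==> (c v w == c u v)].
  by exists v => //; exists (c u v) => w wS wv; apply/eqP/vmono; rewrite !inE wv.
rewrite negb_forall => /existsP[t]; rewrite negb_imply !inE.
case/andP=> /andP[tv tS] cvt.
have tu : t != u.
  by apply: contraNneq cvt => ->; rewrite eq_sym color_symC.
have ctu : c t u = k by rewrite color_symC //; apply: uk.
have cvtk : c v t = k.
  have [] := rainbow_freeE noR uv _ tu; first by rewrite eq_sym.
  - by move=> e; rewrite e eqxx in cvt.
  - by rewrite ctu.
  - by move=> e; rewrite -e ctu eqxx in cuv.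
exists t => //; exists k => z zS zt.
have [->|zu] := eqVneq z u => //.
have [->|zv] := eqVneq z v; first by rewrite color_symC.
have czu : c z u = k by rewrite color_symC //; apply: uk.
apply/eqP; have := noC u v t z; apply: contraNT => ctz.
rewrite /proper_cycle4 /= !inE !negb_or uv cvtk czu cuv ctz.
by rewrite [k == _]eq_sym ctz [k == _]eq_sym cuv ![_ == t]eq_sym ![_ == z]eq_sym
   tu zu tv zv zt.
Qed.

Lemma proper_cycle4_rot (x y z w : K) :
  proper_cycle4 x y z w -> proper_cycle4 y z w x.
Proof.
rewrite /proper_cycle4 => /andP[Uxyzw /and4P[-> -> -> ->]].
by rewrite !andbT -(rot_uniq 3).
Qed.

(** Suppose that [v] saw four different colors on the cycle.  The triangle on
    [v] and an edge of the cycle forces that edge to repeat the color of one of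
    the two edges from [v] to its ends.  As consecutive edges of the cycle
    differ in color, each of [x y], [y z], [z w], [w x] takes the color coming
    from its first end, or each takes the one coming from its second end.  The
    chord [x z] repeats the color of [v x] or of [v z]; in all four cases one of
    the triangles [x y z] and [x z w] is rainbow. *)
Lemma few_colors_on_cycle (x y z w v : K) :
  rainbow_free -> proper_cycle4 x y z w -> v \notin [set x; y; z; w] ->
  size (undup [seq c v t | t in [set x; y; z; w]]) <= 3.
Proof.
move=> noR /andP[]; rewrite /= !inE !negb_or !andbT.
case/and3P=> /and3P[xy xz xw] /andP[yz yw] zw.
case/and4P=> /eqP c1 /eqP c2 /eqP c3 /eqP c4.
case/andP=> /andP[/andP[vx vy] vz] vw.
have leB : #|[set x; y; z; w]| <= 4.
  by rewrite -!setUA !cardsU1 cards1; do 3!case: (_ \notin _).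
rewrite -ltnS; apply: leq_trans leB.
have tri s t : v != s -> v != t -> s != t ->
    [\/ c v s = c s t, c s t = c v t | c v t = c v s].
  move=> vs vt st; rewrite [c v t]color_symC //.
  by apply: rainbow_freeE; rewrite // eq_sym.
have coll s t : s \in [set x; y; z; w] -> t \in [set x; y; z; w] -> s != t ->
    c v s = c v t ->
    size (undup [seq c v t | t in [set x; y; z; w]]) < #|[set x; y; z; w]|.
  by move=> *; apply: (@size_undup_image_noninj _ _ _ _ s t).
have [/coll->//|/eqP vxy] := eqVneq (c v x) (c v y); rewrite ?inE ?eqxx ?orbT //.
have [/coll->//|/eqP vxz] := eqVneq (c v x) (c v z); rewrite ?inE ?eqxx ?orbT //.
have [/coll->//|/eqP vxw] := eqVneq (c v x) (c v w); rewrite ?inE ?eqxx ?orbT //.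
have [/coll->//|/eqP vyz] := eqVneq (c v y) (c v z); rewrite ?inE ?eqxx ?orbT //.
have [/coll->//|/eqP vyw] := eqVneq (c v y) (c v w); rewrite ?inE ?eqxx ?orbT //.
have [/coll->//|/eqP vzw] := eqVneq (c v z) (c v w); rewrite ?inE ?eqxx ?orbT //.
have cwx : c x w = c w x by rewrite color_symC.
have czx : c z x = c x z by rewrite [RHS]color_symC.
have zx : z != x by rewrite eq_sym.
have wx : w != x by rewrite eq_sym.
(* [T1] to [T4] orient the cycle, [T5] colors the chord [x z], and [T6], [T7]
   are the two triangles that the chord cuts off. *)
have T1 := tri x y vx vy xy.
have T2 := tri y z vy vz yz.
have T3 := tri z w vz vw zw.
have T4 := tri x w vx vw xw.
have T5 := tri x z vx vz xz.
have T6 := rainbow_freeE noR xy yz zx.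
have T7 := rainbow_freeE noR xz zw wx.
exfalso.
by case: T1 => ?; try congruence; case: T2 => ?; try congruence;
   case: T3 => ?; try congruence; case: T4 => ?; try congruence;
   case: T5 => ?; try congruence; case: T6 => ?; try congruence;
   case: T7 => ?; congruence.
Qed.

(** * Splitting off a small set *)

Lemma color_degree_induced_ge2 (B : {set K}) (v : induced B) x y :
  x \in B -> y \in B -> val v != x -> val v != y -> c (val v) x != c (val v) y ->
  1 < color_degree v.
Proof.
move=> xB yB vx vy; apply: size_undup_gt1; apply/imageP.
- by exists (Sub x xB) => //; apply: complK.
- by exists (Sub y yB) => //; apply: complK.
Qed.

(** The bound on [#|B|] keeps the other part non-empty: a color degree of at
    least [a + 3 >= 5] needs more than four vertices. *)
Lemma feasible_of_small (a : nat) (B : {set K}) :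
  2 <= a -> 0 < #|K| -> a + 3 <= min_color_degree K ->
  B != set0 -> #|B| <= 4 ->
  (forall v, v \in B -> exists x y, [/\ x \in B, y \in B, v != x, v != y &
     c v x != c v y]) ->
  (forall v, v \notin B -> size (undup [seq c v t | t in B]) <= 3) ->
  feasible_partition a 2 (~: B) B.
Proof.
move=> a2 K0 /(leq_min_color_degreeP _ K0) degK B0 B4 inB outB.
have A0 : ~: B != set0.
  case/card_gt0P: K0 => v0 _; rewrite -card_gt0.
  have := leq_trans (degK v0) (color_degree_le_card v0).
  rewrite -(cardsC B) lt0n; apply: contraTneq => ->.
  by rewrite addn0 -ltnNge addn3 (leq_ltn_trans B4) // !ltnS.
have card_ind (S : {set K}) : S != set0 -> 0 < #|induced S|.
  by case/set0Pn=> s sS; apply/card_gt0P; exists (Sub s sS).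
split.
  split; [exact: A0 | exact: B0 | by rewrite setUC setUCr | ].
  by rewrite -setI_eq0 setIC setICr.
split; apply/leq_min_color_degreeP; rewrite ?card_ind //.
  move=> v; rewrite -(leq_add2r 3); apply: leq_trans (degK (val v)) _.
  apply: leq_trans (color_degree_le_induced v) _.
  by rewrite leq_add2l setCK outB //; have := valP v; rewrite inE.
move=> v; have [x [y [xB yB vx vy cxy]]] := inB _ (valP v).
exact: color_degree_induced_ge2 cxy.
Qed.

End CompleteGraph.

Theorem theorem1p5 (a n : nat) (C : eqType) (K : ecgraph C) :
  2 <= a ->
  0 < n ->
  #|K| = n ->
  complete K ->
  a + 3 <= min_color_degree K ->
  exists A B : {set K}, feasible_partition a 2 A B.
Proof.
move=> a2 n0 cardK complK degK; rewrite -cardK in n0.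
have [|noR] := boolP [exists t : K * K * K, rainbow t.1.1 t.1.2 t.2].
  case/existsP=> -[[x y] z] /= /andP[].
  rewrite /= !inE !negb_or !andbT => /andP[/andP[xy xz] yz].
  case/andP=> /andP[c1 c3] c2.
  have leB : #|[set x; y; z]| <= 3.
    by rewrite -!setUA !cardsU1 cards1; do 2!case: (_ \notin _).
  exists (~: [set x; y; z]), [set x; y; z]; apply: feasible_of_small => //.
  - by apply/set0Pn; exists x; rewrite !inE eqxx.
  - exact: leq_trans leB _.
  - move=> v; rewrite !inE -orbA => /or3P[] /eqP->.
    + exists y, z; rewrite !inE !eqxx ?orbT; split=> //.
      by rewrite [color x z]color_symC.
    + exists x, z; rewrite !inE !eqxx ?orbT; split=> //; first by rewrite eq_sym.
      by rewrite [color y x]color_symC // eq_sym.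
    + exists x, y; rewrite !inE !eqxx ?orbT; split=> //; rewrite 1?eq_sym //.
      by rewrite [color z y]color_symC // eq_sym.
  - by move=> v _; apply: leq_trans (size_undup_image _ _) leB.
have {}noR : rainbow_free K.
  move=> x y z; apply: contra noR => xyz.
  by apply/existsP; exists (x, y, z).
have [|noC] := boolP [exists t : K * K * K * K,
    proper_cycle4 t.1.1.1 t.1.1.2 t.1.2 t.2].
  case/existsP=> -[[[x y] z] w] /= cyc.
  have leB : #|[set x; y; z; w]| <= 4.
    by rewrite -!setUA !cardsU1 cards1; do 3!case: (_ \notin _).
  exists (~: [set x; y; z; w]), [set x; y; z; w]; apply: feasible_of_small => //.
  - by apply/set0Pn; exists x; rewrite !inE eqxx.
  - have ends_differ (p q r s : K) : proper_cycle4 p q r s ->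
        [/\ q != p, q != r & color q p != color q r].
      case/andP; rewrite /= !inE !negb_or.
      case/and4P=> /and3P[pq _ _] /andP[qr _] _ _ /and4P[cpq _ _ _].
      by rewrite eq_sym -(color_symC complK pq).
    have cyc2 := proper_cycle4_rot cyc.
    have cyc3 := proper_cycle4_rot cyc2.
    have cyc4 := proper_cycle4_rot cyc3.
    move=> v; rewrite !inE -!orbA => /or4P[] /eqP->.
    + by have [] := ends_differ _ _ _ _ cyc4; exists w, y; rewrite !inE !eqxx ?orbT.
    + by have [] := ends_differ _ _ _ _ cyc; exists x, z; rewrite !inE !eqxx ?orbT.
    + by have [] := ends_differ _ _ _ _ cyc2; exists y, w; rewrite !inE !eqxx ?orbT.
    + by have [] := ends_differ _ _ _ _ cyc3; exists z, x; rewrite !inE !eqxx ?orbT.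
  - by move=> v; apply: few_colors_on_cycle.
have {}noC (x y z w : K) : ~~ proper_cycle4 x y z w.
  apply: contra noC => cyc.
  by apply/existsP; exists (x, y, z, w).
have K0 : [set: K] != set0 by rewrite -card_gt0 cardsT.
have [u _ [k uk]] := monochromatic_star complK noR noC K0.
have := proj1 (leq_min_color_degreeP _ n0) degK u.
rewrite leqNgt => /negP[]; rewrite addn3 ltnS.
apply: leq_trans (_ : 1 <= _) => //; apply: size_undup_constant (k) _ => l.
case/imageP=> w uw ->; apply: uk; first by rewrite inE.
by apply: contraTneq uw => ->; rewrite -topredE /= adj_irrefl.
Qed.
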